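(* Every countably tight space in class $\mathcal{RC}$ is Corson compact.
   Context: All spaces are completely regular Hausdorff; maps are continuous. A retraction is a map $f\colon X\to Y$ having a right inverse, i.e. a continuous $g\colon Y\to X$ with $fg=\mathrm{id}_Y$. An inverse sequence is an inverse system $\mathbb S=\langle X_\xi,p_\xi^\eta,\lambda\rangle$ indexed by an ordinal $\lambda$. It is continuous if for every limit ordinal $\delta<\lambda$ the space $X_\delta$ together with the maps $p_\xi^\delta$ ($\xi<\delta$) is the inverse limit of $\mathbb S\restriction\delta$. $\mathcal{RC}$ is the smallest class of compact spaces which contains all metrizable compact spaces and is closed under continuous (Hausdorff) images and under limits of continuous inverse sequences whose bonding maps are retractions. A compact space is Corson compact if for some $\kappa$ it embeds into the $\Sigma$-product $\Sigma(\kappa)=\{x\in[0,1]^\kappa: |\{\alpha<\kappa: x(\alpha)\neq 0\}|\le\aleph_0\}$. A space $X$ is countably tight if whenever $x\in\operatorname{cl}A$, $A\subseteq X$, there is a countable $B\subseteq A$ with $x\in\operatorname{cl}B$. *)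

(* Defs.v *)
From HB Require Import structures.
From mathcomp Require Import all_boot all_order all_algebra.
From mathcomp Require Import all_classical all_reals wochoice.
From mathcomp Require Import topology normedtype.

Set Implicit Arguments.
Unset Strict Implicit.
Unset Printing Implicit Defensive.

Import Order.TTheory GRing.Theory Num.Theory.
Import numFieldNormedType.Exports.

Local Open Scope classical_set_scope.
Local Open Scope ring_scope.

Definition homeomorphism (X Y : topologicalType) (f : X -> Y) : Prop :=
  continuous f /\
  exists g : Y -> X, [/\ continuous g, cancel f g & cancel g f].

Definition homeomorphic (X Y : topologicalType) : Prop :=
  exists f : X -> Y, homeomorphism f.

Definition retraction (X Y : topologicalType) (f : X -> Y) : Prop :=
  continuous f /\ exists g : Y -> X, continuous g /\ cancel g f.

Definition metrizable (R : realType) (X : topologicalType) : Prop :=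
  exists M : metricType R, homeomorphic X M.

Definition countably_tight (X : topologicalType) : Prop :=
  forall (A : set X) (x : X), closure A x ->
    exists B : set X, [/\ B `<=` A, countable B & closure B x].

Record inverse_system (I : choiceType) (le : rel I) := InverseSystem {
  ispace :> I -> topologicalType ;
  bond : forall i j : I, le i j -> ispace j -> ispace i ;
  bond_continuous : forall (i j : I) (ij : le i j), continuous (bond ij) ;
  bond_id : forall (i : I) (ii : le i i) (x : ispace i), bond ii x = x ;
  bond_comp : forall (i j k : I) (ij : le i j) (jk : le j k) (ik : le i k)
    (x : ispace k), bond ij (bond jk x) = bond ik x
}.

Arguments bond {I le} _ {i j} ij x.

Definition threads (I : choiceType) (le : rel I) (S : inverse_system le) :
    set (prod_topology (fun i : I => S i)) :=
  [set x | forall (i j : I) (ij : le i j), bond S ij (x j) = x i].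

Arguments threads {I le} S.

Definition inverse_limit (I : choiceType) (le : rel I) (S : inverse_system le) :
  topologicalType := set_type (threads S).

Arguments inverse_limit {I le} S.

(* The canonical map X -> inverse_limit S induced by the pi_i is defined and
   is a homeomorphism. *)
Definition is_inverse_limit (I : choiceType) (le : rel I)
    (S : inverse_system le) (X : topologicalType)
    (pi : forall i : I, X -> S i) : Prop :=
  exists h : X -> inverse_limit S,
    homeomorphism h /\ forall (x : X) (i : I), set_val (h x) i = pi i x.

(* An ordinal is represented by a type I with le : rel I such that
   well_order le, a reflexive order; below le d i means i < d. *)

Definition below (I : choiceType) (le : rel I) (d : I) : pred I :=
  fun i => le i d && (i != d).

Definition segment (I : choiceType) (le : rel I) (d : I) : choiceType :=
  {i : I | below le d i}.

Definition segment_le (I : choiceType) (le : rel I) (d : I) :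
    rel (segment le d) :=
  fun i j => le (val i) (val j).

Definition restrict (I : choiceType) (le : rel I) (S : inverse_system le)
    (d : I) : inverse_system (@segment_le I le d) :=
  @InverseSystem (segment le d) (@segment_le I le d)
    (fun i => S (val i))
    (fun i j ij => @bond I le S (val i) (val j) ij)
    (fun i j ij => @bond_continuous I le S (val i) (val j) ij)
    (fun i ii x => @bond_id I le S (val i) ii x)
    (fun i j k ij jk ik x =>
       @bond_comp I le S (val i) (val j) (val k) ij jk ik x).

Lemma segment_leP (I : choiceType) (le : rel I) (d : I) (i : segment le d) :
  le (val i) d.
Proof. by case/andP: (valP i). Qed.

(* Zero is not counted as a limit ordinal. *)
Definition limit_index (I : choiceType) (le : rel I) (d : I) : Prop :=
  (exists i : I, below le d i) /\
  forall i : I, below le d i -> exists j : I, below le d j /\ below le j i.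

Definition continuous_sequence (I : choiceType) (le : rel I)
    (S : inverse_system le) : Prop :=
  forall d : I, limit_index le d ->
    is_inverse_limit (S := restrict S d)
      (fun i : segment le d => bond S (segment_leP i)).

Inductive RC (R : realType) : topologicalType -> Prop :=
| RC_metrizable (X : topologicalType) :
    compact [set: X] -> metrizable R X -> RC R X
| RC_image (X Y : topologicalType) (f : X -> Y) :
    RC R X -> hausdorff_space Y -> continuous f -> range f = [set: Y] -> RC R Y
| RC_limit (I : choiceType) (le : rel I) (S : inverse_system le) :
    well_order le ->
    continuous_sequence S ->
    (forall (i j : I) (ij : le i j), retraction (bond S ij)) ->
    (forall i : I, RC R (S i)) ->
    RC R (inverse_limit S).

(* A subset of R^K rather than of [0,1]^K; the subspace topology is the same. *)
Definition Sigma_product (R : realType) (K : Type) : set {ptws K -> R} :=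
  [set x | (forall a : K, 0 <= x a <= 1) /\ countable [set a : K | x a != 0]].

Arguments Sigma_product : clear implicits.

Definition Corson_compact (R : realType) (X : topologicalType) : Prop :=
  compact [set: X] /\
  exists (K : Type) (A : set {ptws K -> R}),
    A `<=` Sigma_product R K /\ homeomorphic X (set_type A).

(* Main.v *)
Require Import Defs.
From Stdlib Require Eqdep_dec.
From HB Require Import structures.
From mathcomp Require Import all_boot all_order all_algebra.
From mathcomp Require Import all_classical all_reals topology normedtype.
From mathcomp Require Import wochoice.

Set Implicit Arguments.
Unset Strict Implicit.
Unset Printing Implicit Defensive.

Import Order.TTheory GRing.Theory Num.Theory.
Import numFieldNormedType.Exports.

Local Open Scope classical_set_scope.
Local Open Scope ring_scope.

(* A compact space X is Corson if, for all suitably closed sets M of points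
   and subsets of X, the sets in M separate any two points x, y of the closure
   of the points in M, in the weak sense that some A in M has x outside the
   closure of the points of M in A and y outside the closure of the points of M
   not in A (a form of Bandlow's elementary submodel characterization). By
   induction over RC, every countably tight image f(Z) of a space Z in RC has
   this property. For a limit Z of retractions r_i one passes to the points of
   Z lying in the closure of countably many r_j(Z), whose image is all of f(Z)
   by tightness: two such points with different images under f have different
   images under some f r_i with i in M, so the sets for f(r_i(Z)) pull back to
   Z; a compactness argument pushes them forward to f(Z). Conversely, in a
   countably tight space the property yields a retraction onto the closure of
   the points of M for each M; the retractions along an increasing chain of M's
   move each point only countably often, and the differences of functions
   composed with consecutive ones embed X into a Sigma-product. *)

(** * Compactness, cluster points and images *)

Lemma countableU (T : Type) (A B : set T) :
  countable A -> countable B -> countable (A `|` B).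
Proof.
by move=> cA cB; rewrite -bigcup2inE; apply: bigcup_countable => // -[|[|]].
Qed.

(** If [Q K] fails, the sets [W] such that [Q] holds for [K] minus [W] form a proper filter; its
    cluster point in [K] contradicts the local hypothesis. *)
Lemma compact_set_ind (T : topologicalType) (K : set T) (Q : set T -> Prop) :
  compact K -> Q set0 ->
  (forall U V, Q U -> Q V -> Q (U `|` V)) ->
  (forall U V, U `<=` V -> Q V -> Q U) ->
  (forall x, K x -> exists2 U, nbhs x U & Q U) -> Q K.
Proof.
move=> cK Q0 QU Qsub Qloc; apply: contrapT => nQK.
pose F : set_system T := [set W | Q (K `\` W)].
have FF : ProperFilter F.
  split; first by rewrite /F /= setD0.
  split; first by rewrite /F /= setDT.
    by move=> A B FA FB; rewrite /F /= setDIr; exact: QU.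
  by move=> A B AB; apply: Qsub; exact: setDS.
have [x [Kx clx]] : K `&` cluster F !=set0.
  by apply: cK; rewrite /F /= setDv.
have [U nU QUx] := Qloc _ Kx.
have FU : F (~` U) by apply: Qsub QUx; rewrite setDE setCK; exact: subIsetr.
by have [y []] := clx _ _ FU nU.
Qed.

(** Serves to prove continuity of maps whose values are pinned down by closed conditions: these
    conditions pass to cluster points. *)
Lemma compact_cvg_unique_cluster (T : topologicalType) (y : T)
    (F : set_system T) :
  hausdorff_space T -> compact [set: T] -> ProperFilter F ->
  (forall z, cluster F z -> z = y) -> F --> y.
Proof.
move=> hT cT FF clF.
apply: (@compact_cluster_set1 _ _ _ setT) => //; first exact: filterT.
  exact: filterT.
have [z [_ clz]] := cT F FF filterT.
by rewrite eqEsubset; split=> [w /clF //|w ->]; rewrite -(clF _ clz).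
Qed.

Lemma cluster_closed (T : topologicalType) (F : set_system T) (A : set T) z :
  closed A -> F A -> cluster F z -> A z.
Proof.
by move=> cA FA; rewrite clusterE => /(_ _ FA); rewrite -(closure_id A).1.
Qed.

Lemma cluster_cvg_image (T U : topologicalType) (f : T -> U)
    (F : set_system T) z l :
  hausdorff_space U -> {for z, continuous f} -> cluster F z ->
  f @ F --> l -> f z = l.
Proof.
move=> hU cf clz fl; apply: hU => A B nA nB.
have [w [/= Bw Aw]] := clz _ _ (fl _ nB) (cf _ nA).
by exists (f w).
Qed.

Lemma closure_image_compact (Z X : topologicalType) (f : Z -> X) (A : set Z) :
  compact [set: Z] -> hausdorff_space X -> continuous f ->
  closure (f @` A) `<=` f @` closure A.
Proof.
move=> cZ hX cf.
have cA : compact (closure A).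
  by apply: subclosed_compact cZ _ => //; exact: closed_closure.
have := continuous_compact (continuous_subspaceT cf) cA.
move=> /(compact_closed hX) cfA x.
move=> /(closureS (@image_subset _ _ f _ _ (@subset_closure _ A))).
by rewrite -(closure_id _).1.
Qed.

Lemma image_closure_sub (Z X : topologicalType) (f : Z -> X) (A : set Z) :
  continuous f -> f @` closure A `<=` closure (f @` A).
Proof.
move=> cf _ [z Az <-] V nV.
have [w [Aw Vw]] := Az _ (cf _ _ nV).
by exists (f w); split=> //; exists w.
Qed.

(** * Closed unbounded families *)

Section clubs.
Context (H : Type).
Implicit Types (c : seq H -> set H) (M G : set H) (Q : set H -> Prop).

Definition closed_under c M :=
  forall s, all (fun h => h \in M) s -> c s `<=` M.

(* Quantification over the sets closed under countably many finitary
   operations; this plays the part of quantifying over elementary submodels. *)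
Definition club Q :=
  exists2 c, (forall s, countable (c s)) & forall M, closed_under c M -> Q M.

Lemma club_imp Q Q' : (forall M, Q M -> Q' M) -> club Q -> club Q'.
Proof. by move=> QQ' [c cc Qc]; exists c => // M /Qc/QQ'. Qed.

Lemma club_and Q Q' : club Q -> club Q' -> club (fun M => Q M /\ Q' M).
Proof.
move=> [c cc Qc] [c' cc' Qc']; exists (fun s => c s `|` c' s).
  by move=> s; exact: countableU.
by move=> M cM; split; [apply: Qc|apply: Qc'] => s /cM sM h ch; apply: sM; [left|right].
Qed.

Lemma club_closed_under c : (forall s, countable (c s)) -> club (closed_under c).
Proof. by move=> cc; exists c. Qed.

Lemma club_const (A : set H) : countable A -> club (fun M => A `<=` M).
Proof. by move=> cA; exists (fun=> A) => // M /(_ [::]); apply. Qed.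

Lemma club_op1 (f : H -> set H) : (forall h, countable (f h)) ->
  club (fun M => forall h, M h -> f h `<=` M).
Proof.
move=> cf; exists (fun s => if s is [:: h] then f h else set0).
  by move=> [|h []].
by move=> M cM h Mh; apply: (cM [:: h]); rewrite /= mem_set.
Qed.

Lemma club_op2 (f : H -> H -> set H) : (forall h k, countable (f h k)) ->
  club (fun M => forall h k, M h -> M k -> f h k `<=` M).
Proof.
move=> cf; exists (fun s => if s is [:: h; k] then f h k else set0).
  by move=> [|h [|k []]].
by move=> M cM h k Mh Mk; apply: (cM [:: h; k]); rewrite /= !mem_set.
Qed.

Lemma all_bigcup_chain (I : Type) (F : I -> set H) (i0 : I) s :
  (forall i j, F i `<=` F j \/ F j `<=` F i) ->
  all (fun h => h \in \bigcup_i F i) s -> exists i, all (fun h => h \in F i) s.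
Proof.
move=> Fchain; elim: s => [|h s IH] /=; first by exists i0.
move=> /andP[/set_mem[i _ Fih] /IH[j sj]].
have [ij|ji] := Fchain i j.
  by exists j; rewrite sj mem_set//; exact: ij.
exists i; rewrite mem_set//=; apply: sub_all sj => k /set_mem Fjk.
by rewrite mem_set//; exact: ji.
Qed.

(** Operations take finitely many arguments, which already lie in one member of the chain. *)
Lemma closed_under_bigcup_chain (I : Type) (F : I -> set H) c (i0 : I) :
  (forall i j, F i `<=` F j \/ F j `<=` F i) ->
  (forall i, closed_under c (F i)) -> closed_under c (\bigcup_i F i).
Proof.
move=> Fchain cF s /(all_bigcup_chain i0 Fchain)[i /cF Fi] h /Fi Fih.
by exists i.
Qed.

Definition hull c G : set H :=
  [set h | forall M, closed_under c M -> G `<=` M -> M h].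

Lemma hull_sub c G : G `<=` hull c G.
Proof. by move=> h Gh M _; apply. Qed.

Lemma hull_min c G M : closed_under c M -> G `<=` M -> hull c G `<=` M.
Proof. by move=> cM GM h; apply. Qed.

Lemma hull_closed c G : closed_under c (hull c G).
Proof.
move=> s sG h csh M cM GM; apply: (cM s) => //.
by apply: sub_all sG => k /set_mem kG; rewrite mem_set//; exact: kG.
Qed.

Lemma hullS c G G' : G `<=` G' -> hull c G `<=` hull c G'.
Proof.
move=> GG'; apply: hull_min; first exact: hull_closed.
by apply: subset_trans GG' _; exact: hull_sub.
Qed.

Lemma countable_seqs (A : set H) : countable A ->
  countable [set s | all (fun h => h \in A) s].
Proof.
move=> /countable_injP[f fI].
have fsI : {in [set s | all (fun h => h \in A) s] &, injective (map f)}.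
  move=> s t; rewrite !inE; elim: s t => [|x s IH] [|y t] //= /andP[Ax As].
  move=> /andP[Ay At] [fxy fst]; rewrite (fI x y) //; congr (_ :: _).
  exact: IH.
apply/pcard_injP.
exists (fun s => choice.pickle (map f s)) => s t sA tA /(pcan_inj choice.pickleK).
exact: fsI.
Qed.

Lemma hull_countable c G : (forall s, countable (c s)) -> countable G ->
  countable (hull c G).
Proof.
move=> cc cG.
(* The hull is exhausted by countably many rounds of applying [c], each of which preserves
   countability. *)
pose step A := A `|` \bigcup_(s in [set s | all (fun h => h \in A) s]) c s.
pose N n := iter n step G.
have cN n : countable (N n).
  elim: n => // n IH; rewrite /N iterS; apply: countableU => //.
  by apply: bigcup_countable => //; exact: countable_seqs.
have NS n m : (n <= m)%N -> N n `<=` N m.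
  elim: m => [|m IH]; first by rewrite leqn0 => /eqP->.
  rewrite leq_eqVlt => /orP[/eqP-> //|]; rewrite ltnS => /IH Nnm.
  by apply: subset_trans Nnm _ => h Nh; left.
have Nchain n m : N n `<=` N m \/ N m `<=` N n.
  by case: (leqP n m) => [/NS|/ltnW/NS]; [left|right].
suff: hull c G `<=` \bigcup_n N n.
  by move=> /subset_card_le/sub_countable; apply; exact: bigcup_countable.
apply: hull_min; last by move=> h Gh; exists 0%N.
move=> s /(all_bigcup_chain 0%N Nchain)[n sN] h csh.
by exists n.+1 => //; right; exists s.
Qed.

End clubs.

(** A diagonal intersection: only indices coded in [M] impose a condition, so arbitrarily many clubs
    can be combined. The operations read the index from the first entry and apply those of that
    index to the rest; by injectivity a sequence decodes in at most one way, which keeps the values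
    countable. *)
Lemma club_diag (H : Type) (I : Type) (J : I -> Type) (idx : I -> H)
    (emb : forall i, J i -> H) (Q : forall i, set (J i) -> Prop) :
  injective idx -> (forall i, injective (@emb i)) ->
  (forall i, club (Q i)) ->
  club (fun M => forall i, M (idx i) -> Q i (@emb i @^-1` M)).
Proof.
move=> idxI embI clQ.
have clQ' i : exists c : seq (J i) -> set (J i),
    (forall s, countable (c s)) /\ forall M, closed_under c M -> Q i M.
  by have [c cc cQ] := clQ i; exists c.
pose c i := sval (cid (clQ' i)); have cP i := svalP (cid (clQ' i)).
pose d s : set H := [set h | exists i t,
  s = idx i :: map (@emb i) t /\ (@emb i @` c i t) h].
exists d.
  move=> s; case: (pselect (exists i t, s = idx i :: map (@emb i) t)); last first.
    move=> ns; suff -> : d s = set0 by [].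
    by rewrite -subset0 => h [i [t [st _]]]; apply: ns; exists i, t.
  move=> [i [t st]]; apply: (@sub_countable _ _ _ (@emb i @` c i t)); last first.
    by apply: sub_countable (card_image_le _ _) _; exact: (cP i).1.
  apply: subset_card_le => h [j [u [su]]].
  rewrite st in su; case: su => /idxI ij; case: _ / ij u => u.
  by move=> /(inj_map (embI i)) ->.
move=> M dM i Mi; apply: (cP i).2 => s sM h csh /=.
apply: (dM (idx i :: map (@emb i) s)); last by exists i, s; split=> //; exists h.
rewrite /= mem_set//= all_map; apply: sub_all sM => k /=.
by rewrite !inE.
Qed.

(** * Separation by coded sets *)

(** Choice in the form of a countable-valued operation: empty if [P] is empty, otherwise a
    singleton. *)
Definition pick1 (T : Type) (P : set T) : set T :=
  if pselect (exists z, P z) is left h then [set sval (cid h)] else set0.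

Lemma pick1_sub (T : Type) (P : set T) : pick1 P `<=` P.
Proof. by rewrite /pick1; case: pselect => [h z ->|_ z []]; exact: (svalP (cid h)). Qed.

Lemma pick1_ex (T : Type) (P : set T) z : P z -> exists w, pick1 P w.
Proof.
move=> Pz; rewrite /pick1; case: pselect => [h|[]]; last by exists z.
by exists (sval (cid h)).
Qed.

Lemma countable_pick1 (T : Type) (P : set T) : countable (pick1 P).
Proof. by rewrite /pick1; case: pselect. Qed.

Lemma countable_image (T U : Type) (f : T -> U) (A : set T) :
  countable A -> countable (f @` A).
Proof. exact/sub_countable/card_image_le. Qed.

(** The universe from which models are taken; the extra codes [H] store models belonging to other
    spaces. *)
Inductive univ (X H : Type) := Pt of X | St of set X | Ex of H.

Definition trace (X H : Type) (P : set X) (M : set (univ X H)) : set X :=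
  [set x | P x /\ M (Pt H x)].

(** Stated relative to [P], so that the image of a map can be treated inside its target without
    forming a subspace. *)
Definition club_separated (X : topologicalType) (P : set X) :=
  exists H : Type, club (fun M : set (univ X H) =>
    forall x y, x <> y -> closure (trace P M) x -> closure (trace P M) y ->
    exists A, [/\ M (St H A), ~ closure (A `&` trace P M) x
      & ~ closure (trace P M `\` A) y]).

Lemma not_closureU (T : topologicalType) (A B : set T) z :
  ~ closure A z -> ~ closure B z -> ~ closure (A `|` B) z.
Proof. by move=> nA nB; rewrite closureU => -[]. Qed.

(** Compactness is used twice: for a fixed point of [F] finitely many sets are united to deal with
    all of [G], and then finitely many such unions are intersected to deal with all of [F]. *)
Lemma lattice_separation (T : topologicalType) (L : set (set T))
    (D F G : set T) :
  compact F -> compact G -> L set0 -> L [set: T] ->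
  (forall A B, L A -> L B -> L (A `|` B)) ->
  (forall A B, L A -> L B -> L (A `&` B)) ->
  (forall z w, F z -> G w ->
    exists A, [/\ L A, ~ closure (A `&` D) z & ~ closure (D `\` A) w]) ->
  exists A, [/\ L A, forall z, F z -> ~ closure (A `&` D) z
    & forall w, G w -> ~ closure (D `\` A) w].
Proof.
move=> cF cG L0 LT LU LI sepL.
have nbhsC (A : set T) z : ~ closure A z -> nbhs z (~` closure A).
  by move=> nA; apply: open_nbhs_nbhs; split=> //; exact/closed_openC/closed_closure.
have sepG z : F z -> exists A, [/\ L A, ~ closure (A `&` D) z
    & forall w, G w -> ~ closure (D `\` A) w].
  move=> Fz; pose Q (V : set T) := exists A, [/\ L A, ~ closure (A `&` D) z
    & forall w, V w -> ~ closure (D `\` A) w].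
  apply: (@compact_set_ind _ G Q) => //.
  - by exists set0; split=> //; rewrite set0I closure0.
  - move=> U V [A [LA Az AU]] [B [LB Bz BV]]; exists (A `|` B); split.
    + exact: LU.
    + by rewrite setIUl; exact: not_closureU.
    + move=> w; rewrite setDUr => UVw /closureI[wA wB].
      by case: UVw => [/AU|/BV]; exact.
  - by move=> U V UV [A [LA Az AV]]; exists A; split=> // w /UV/AV.
  - move=> w /(sepL _ _ Fz)[A [LA Az Aw]]; exists (~` closure (D `\` A)).
      exact: nbhsC.
    by exists A; split.
pose Q (V : set T) := exists A, [/\ L A, forall z, V z -> ~ closure (A `&` D) z
    & forall w, G w -> ~ closure (D `\` A) w].
apply: (@compact_set_ind _ F Q) => //.
- by exists setT; split=> // w _; rewrite setDT closure0.
- move=> U V [A [LA UA AG]] [B [LB VB BG]]; exists (A `&` B); split.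
  + exact: LI.
  + by move=> z UVz; rewrite setIIl => /closureI[zA zB]; case: UVz => [/UA|/VB]; exact.
  + by move=> w Gw; rewrite setDIr; apply: not_closureU; [exact: AG|exact: BG].
- by move=> U V UV [A [LA Az AV]]; exists A; split=> // w /UV/Az.
- move=> z /sepG[A [LA Az AG]]; exists (~` closure (A `&` D)); first exact: nbhsC.
  by exists A; split.
Qed.

(** The fibres over two distinct points are compact, so [lattice_separation] separates them by one
    coded set; its image separates the points, because the closure of an image lies in the image of
    the closure. *)
Lemma club_separated_image (Z X : topologicalType) (H : Type) (S : set Z)
    (f : Z -> X) :
  compact [set: Z] -> hausdorff_space X -> continuous f ->
  (forall z, exists2 w, S w & f w = f z) ->
  club (fun M : set (univ Z H) => forall z w, f z <> f w ->
    closure (trace S M) z -> closure (trace S M) w ->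
    exists A, [/\ M (St H A), ~ closure (A `&` trace S M) z
      & ~ closure (trace S M `\` A) w]) ->
  club_separated (range f).
Proof.
move=> cZ hX cf fS clS; exists (univ Z H).
set U := univ X _.
(* [lat1] codes the image of a coded set. [lat2] closes the coded sets under union and intersection
   and picks, for a coded set and a coded point, a preimage of the point in that set and [S]. *)
pose lat1 (h : U) : set U :=
  if h is Ex (St A) then [set St (univ Z H) (f @` (S `&` A))] else set0.
pose lat2 (h k : U) : set U := match h, k with
  | Ex (St A), Ex (St B) =>
      [set Ex X (St H (A `|` B))] `|` [set Ex X (St H (A `&` B))]
  | Ex (St A), Pt x =>
      [set Ex X (Pt H z) | z in pick1 [set z | (S `&` A) z /\ f z = x]]
  | _, _ => set0 end.
have lat1c h : countable (lat1 h) by case: h => [x|A|[z|A|h]] /=.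
have lat2c h k : countable (lat2 h k).
  case: h => [?|?|[?|A|?]] //=; case: k => [x|?|[?|B|?]] //=.
    exact/countable_image/countable_pick1.
  exact: countableU.
pose e0 : U := Ex X (St H set0).
have cl0 : club (fun M : set U => [set e0; Ex X (St H setT)] `<=` M).
  by apply: club_const; exact: countableU.
have exI : forall _ : unit, injective (fun h : univ Z H => Ex X h).
  by move=> _ a b [].
(* With a single index, coded by the element [e0] put into every [M], the diagonal lemma merely
   transports [clS] along [Ex]. *)
have clS' := club_diag (idx := fun=> e0) _ exI (fun=> clS).
have {}clS' := clS' (fun 'tt 'tt _ => erefl).
have := club_and (club_and cl0 clS') (club_and (club_op1 lat1c) (club_op2 lat2c)).
apply: club_imp => M [[MC MS] [M1 M2]].
have M0 : M e0 by apply: MC; left.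
have MT : M (Ex X (St H setT)) by apply: MC; right.
move: MS => /(_ tt M0); set N := _ @^-1` M => MS.
set E := trace (range f) M => x y xy Ex' Ey.
set D := trace S N in MS.
have EA A x' : M (Ex X (St H A)) -> E x' -> (f @` (S `&` A)) x' ->
    (f @` (A `&` D)) x'.
  move=> MA [_ Mx'] [z SAz fz].
  have [w w1] := @pick1_ex _ [set z | (S `&` A) z /\ f z = x'] z (conj SAz fz).
  have [[Sw Aw] fw] := pick1_sub w1.
  exists w => //; split=> //; split=> //; apply: (M2 _ _ MA Mx').
  by exists w.
have ED : E `<=` f @` D.
  move=> x' Ex1; have [[z _ zx'] _] := Ex1.
  have [|w [_ Dw] wx'] := EA setT x' MT Ex1; last by exists w.
  by have [u Su fu] := fS z; exists u => //; rewrite fu.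
have clE A : closure (f @` A) `<=` f @` closure A.
  exact: closure_image_compact.
have cfib x' : compact (closure D `&` f @^-1` [set x']).
  apply: (subclosed_compact _ cZ) => //; apply: closedI; first exact: closed_closure.
  apply: closed_comp => [? _|]; first exact: cf.
  exact/accessible_closed_set1/hausdorff_accessible.
have [|||A [MA Ax Ay]] := @lattice_separation _
    [set A | M (Ex X (St H A))] D _ _ (cfib x) (cfib y) M0 MT.
- by move=> A B MA MB; apply: (M2 _ _ MA MB); left.
- by move=> A B MA MB; apply: (M2 _ _ MA MB); right.
- by move=> z w [Dz fz] [Dw fw]; apply: MS => //; rewrite fz fw.
exists (f @` (S `&` A)); split.
- exact: (M1 _ MA).
- move=> /(@closureS _ _ (f @` (A `&` D)) _)/clE[].
    by move=> x' [SA /EA]; apply.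
  move=> z Az fz; apply: (Ax z) => //; split=> //.
  by apply: (closureS _ Az); exact: subIsetr.
- move=> /(@closureS _ _ (f @` (D `\` A)) _)/clE[].
    move=> x' [/ED[z Dz fz] nA]; exists z => //; split=> // Az.
    by apply: nA; exists z => //; split=> //; case: Dz.
  move=> z Az fz; apply: (Ay z) => //; split=> //.
  by apply: (closureS _ Az); exact: subDsetl.
Qed.

(** * Metrizable spaces and chains of retractions *)

Lemma compact_metrizable_second_countable (R : realType) (Z : topologicalType) :
  compact [set: Z] -> metrizable R Z -> second_countable (T := Z).
Proof.
move=> cZ [M [phi [cphi [psi [cpsi phiK psiK]]]]].
have [[z0 _]|Z0] := pselect (exists z : Z, True); last first.
  exists set0 => //; split=> // z; by case: Z0; exists z.
pose MP : pseudoPMetricType R := HB.pack M (isPointed.Build M (phi z0)).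
have cM : compact [set: MP].
  have -> : [set: MP] = phi @` setT.
    by rewrite eqEsubset; split=> // m _; exists (psi m).
  exact: continuous_compact (continuous_subspaceT cphi) cZ.
have [B cB [Bo Bb]] := compact_second_countable cM.
exists ((fun U => phi @^-1` U) @` B); first exact: countable_image.
split.
  by move=> _ [U BU <-]; apply: open_comp; [move=> ? _; exact: cphi|exact: Bo].
move=> z V nV.
have nV' : nbhs (phi z : M) (psi @^-1` V) by apply: cpsi; rewrite phiK.
have [U [BU Uz] UV] := Bb (phi z) _ nV'.
exists (phi @^-1` U); first by split=> //; exists U.
by move=> w /= /UV /=; rewrite phiK.
Qed.

(** A countable base can be put into every model. The complement of a basic neighbourhood of [z]
    contained in an open set disjoint from a neighbourhood of [w] separates [z] from [w]. *)
Lemma second_countable_club_separated (Z X : topologicalType) (f : Z -> X) :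
  compact [set: Z] -> hausdorff_space Z -> second_countable (T := Z) ->
  hausdorff_space X -> continuous f -> club_separated (range f).
Proof.
move=> cZ hZ [B cB [Bo Bb]] hX cf.
apply: (@club_separated_image _ _ void setT) => // [z|]; first by exists z.
have : club (fun M : set (univ Z void) => (fun U => St void (~` U)) @` B `<=` M).
  by apply: club_const; exact: countable_image.
apply: club_imp => M MB z w fzw _ _.
have zw : z != w by apply/eqP => zw; apply: fzw; rewrite zw.
have [[V W] /= [/set_mem Vz /set_mem Ww] [Vo Wo VW]] :
    exists2 AB : set Z * set Z, z \in AB.1 /\ w \in AB.2 &
      [/\ open AB.1, open AB.2 & AB.1 `&` AB.2 == set0].
  by move: hZ; rewrite open_hausdorff; apply.
have [U [BU Uz] UV] := Bb z V (open_nbhs_nbhs (conj Vo Vz)).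
exists (~` U); split; first by apply: MB; exists U.
- move=> /(_ U (open_nbhs_nbhs (conj (Bo _ BU) Uz))).
  by move=> [u [[]]].
- move=> /(_ W (open_nbhs_nbhs (conj Wo Ww))).
  move=> [u [[_ /contrapT /UV Vu Wu]]].
  by have : (V `&` W) u by []; rewrite (eqP VW).
Qed.

Section retraction_chains.
Context (Z X : topologicalType) (I : eqType) (le : rel I) (r : I -> Z -> Z).
Hypotheses (cZ : compact [set: Z]) (hZ : hausdorff_space Z).
Hypotheses (le_total : total le) (le_trans : transitive le).
Hypothesis r_cont : forall i, continuous (r i).
Hypothesis rr : forall i j z, le i j -> r i (r j z) = r i z.

Let Y (J : set I) := closure (\bigcup_(j in J) range (r j)).

(** A cluster point of the net of the [r i z], [i] in [J], lies in [Y J] and has the same [r j] as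
    [z] for [j] in [J], since [r j] absorbs the later [r i]. Hence it is [z], and by compactness the
    net converges. *)
Lemma chain_cvg (J : set I) z : J !=set0 ->
  (forall w, Y J w -> (forall j, J j -> r j w = r j z) -> w = z) ->
  forall U, nbhs z U -> exists2 j, J j & forall i, J i -> le j i -> U (r i z).
Proof.
move=> [j0 Jj0] zuniq.
have le_refl i : le i i by have := le_total i i; rewrite orbb.
pose F := filter_from J (fun j => [set r i z | i in [set i | J i /\ le j i]]).
have FF : ProperFilter F.
  apply: filter_from_proper; last by move=> j Jj; exists (r j z), j.
  apply: filter_from_filter; first by exists j0.
  move=> i j Ji Jj; have [ij|ji] := orP (le_total i j).
    exists j => // _ [k [Jk jk] <-]; split; exists k => //; split=> //.
    exact: le_trans ij jk.
  exists i => // _ [k [Jk ik] <-]; split; exists k => //; split=> //.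
  exact: le_trans ji ik.
move=> U nU; have : F --> z; last first.
  move=> /(_ _ nU)[j Jj FU]; exists j => // i Ji ji; apply: FU.
  by exists i.
apply: compact_cvg_unique_cluster => // w clw; apply: zuniq.
  rewrite /Y; apply: (cluster_closed _ _ clw); first exact: closed_closure.
  exists j0 => // _ [i [Ji _] <-]; apply: subset_closure.
  by exists i => //; exists z.
move=> j Jj; apply: (cluster_cvg_image hZ (r_cont (i:=j) (x:=w)) clw).
move=> V nV; exists j => // _ [i [Ji ji] <-] /=.
by rewrite rr//; exact: nbhs_singleton.
Qed.

Context (f : Z -> X).
Hypotheses (hX : hausdorff_space X) (tX : countably_tight X).
Hypothesis f_cont : continuous f.
Hypothesis r_inj_closure : forall (J : set I) z w, Y J z -> Y J w ->
  (forall j, J j -> r j z = r j w) -> z = w.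
Hypothesis r_inj : forall z w, (forall i, r i z = r i w) -> z = w.

Let S := [set z | exists J, countable J /\ Y J z].

(* As [X] is countably tight, [S] is large enough: its image is dense and
   closed under closures of countable subsets. *)
Let image_S z : I -> exists2 w, S w & f w = f z.
Proof.
move=> i0.
have Yz : Y setT z.
  move=> U /(chain_cvg (J := setT))[|w _ rwz|i _ /(_ i)]; first by exists i0.
    by apply: r_inj => i; exact: rwz.
  move=> Ur; exists (r i z); split; last first.
    by apply: Ur => //; have := le_total i i; rewrite orbb.
  by exists i => //; exists z.
have : closure (f @` \bigcup_i range (r i)) (f z).
  by apply: image_closure_sub => //; exists z.
move=> /tX[B [BY cB clB]].
have g b : exists i, B b -> (f @` range (r i)) b.
  have [/BY[_ [i _ [y _ <-]] fb]|nB] := pselect (B b); last by exists i0.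
  by exists i => _; exists (r i y) => //; exists y.
pose h b := sval (cid (g b)).
have hP b : B b -> (f @` range (r (h b))) b by exact: svalP (cid (g b)).
have : closure (f @` \bigcup_(i in h @` B) range (r i)) (f z).
  apply: closureS clB => b Bb; have [y ry fy] := hP _ Bb.
  by exists y => //; exists (h b) => //; exists b.
move=> /(closure_image_compact cZ hX f_cont)[w Yw fw].
by exists w => //; exists (h @` B); split=> //; exact: countable_image.
Qed.

Lemma club_separated_chain :
  (forall i, club_separated (range (f \o r i))) -> club_separated (range f).
Proof.
move=> sep_r.
pose H i := sval (cid (sep_r i)).
have clH i : club (fun M : set (univ X (H i)) => _) := svalP (cid (sep_r i)).
(* Extra codes: the indices, and for each index [i] a copy of the universe used for [f \o r i]. *)
pose C := (I + {i : I & univ X (H i)})%type.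
(* Without indices [r_inj] identifies all points of [Z], so [f] is constant. *)
have [i0|nI] := pselect (inhabited I); last first.
  exists void; exists (fun=> set0) => // M _ x y xy clx cly; case: xy.
  have eqf z w : f z = f w.
    by congr f; apply: r_inj => i; case: nI.
  have [_ [[[z _ _] _] _]] := clx setT filterT.
  suff rf (u : X) : closure (trace (range f) M) u -> u = f z.
    by rewrite (rf _ clx) (rf _ cly).
  move=> clu; have : closure [set f z] u.
    by apply: closureS clu => _ [[w _ <-] _]; exact: eqf.
  by rewrite -(closure_id _).1//; exact/accessible_closed_set1/hausdorff_accessible.
apply: (@club_separated_image _ _ C S) => // [z|]; first by case: i0 => i; exact: image_S.
set U := univ Z C.
pose idx i : U := Ex Z (inl i).
pose emb i (h : univ X (H i)) : U := Ex Z (inr (existT _ i h)).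
(* [o1] adds to a coded point of [S] a countable set of indices witnessing membership, and pulls
   coded sets back along [f \o r i]; [o2] adds the image of a coded point under a coded index. *)
pose o1 (h : U) : set U := match h with
  | Pt z => if pselect (S z) is left Sz then idx @` sval (cid Sz) else set0
  | Ex (inr (existT i (St B))) => [set St C ((f \o r i) @^-1` B)]
  | _ => set0 end.
pose o2 (h k : U) : set U := match h, k with
  | Ex (inl i), Pt z => [set @emb i (Pt (H i) (f (r i z)))]
  | _, _ => set0 end.
have co1 h : countable (o1 h).
  case: h => [z|?|[?|[i [?|B|?]]]] //=.
  by case: pselect => // Sz; apply: countable_image; case: (svalP (cid Sz)).
have co2 h k : countable (o2 h k).
  by case: h => [?|?|[?|?]] //=; case: k => [?|?|?] /=.
have idxI : injective idx by move=> a b [].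
have embI i : injective (@emb i).
  by move=> h k [] e; exact: (Eqdep_dec.inj_pair2_eq_dec _ (@eq_comparable I) _ _ _ _ e).
have := club_and (club_diag idxI embI clH) (club_and (club_op1 co1) (club_op2 co2)).
apply: club_imp => M [MH [M1 M2]] z w fzw; set D := trace S M => Dz Dw.
pose J := [set i | M (idx i)].
(* The witnessing indices of each coded point are themselves in [M]. *)
have DY : closure D `<=` Y J.
  rewrite /Y [X in _ `<=` X](closure_id _).1; last exact: closed_closure.
  apply: closureS => u [Su Mu]; move: (M1 _ Mu) => /=.
  case: pselect => // Su' MJ; have [cJ] := svalP (cid Su').
  by apply: closureS; apply: bigcup_subset => i Ji; apply: MJ; exists i.
have J0 : J !=set0.
  by have [_ [[j Jj _] _]] := DY _ Dz setT filterT; exists j.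
have Ycvg u : closure D u -> forall V, nbhs u V ->
    exists2 j, J j & forall i, J i -> le j i -> V (r i u).
  move=> Du; apply: (chain_cvg J0) => v Yv rvu.
  by apply: (r_inj_closure Yv) => //; exact: DY.
(* Otherwise the convergence of [r i z] to [z] and of [r i w] to [w] along [J] would give
   [f z = f w]. *)
have [i Ji frzw] : exists2 i, J i & f (r i z) <> f (r i w).
  apply: contrapT => nJ; apply: fzw; apply: hX => A B nA nB.
  have [j Jj Aj] := Ycvg _ Dz _ (f_cont nA).
  have [k Jk Bk] := Ycvg _ Dw _ (f_cont nB).
  have le_refl l : le l l by have := le_total l l; rewrite orbb.
  have [l [Jl jl kl]] : exists l, [/\ J l, le j l & le k l].
    by have [jk|kj] := orP (le_total j k); [exists k|exists j].
  exists (f (r l z)); split; first exact: Aj.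
  suff -> : f (r l z) = f (r l w) by exact: Bk.
  by apply: contrapT => ne; apply: nJ; exists l.
pose g := f \o r i.
have g_cont : continuous g.
  by move=> u; apply: continuous_comp; [exact: r_cont|exact: f_cont].
pose E := trace (range g) (@emb i @^-1` M).
have gD : g @` D `<=` E.
  move=> _ [u [Su Mu] <-]; split; first by exists u.
  by apply: (M2 _ _ Ji Mu).
have clE v : closure D v -> closure E (g v).
  by move=> Dv; apply: (closureS gD); apply: (image_closure_sub g_cont); exists v.
have [A [MA Az Aw]] := MH i Ji _ _ frzw (clE _ Dz) (clE _ Dw).
exists (g @^-1` A); split; first by apply: (M1 _ MA).
- move=> clz; apply: Az; apply: (@closureS _ (g @` (g @^-1` A `&` D))).
    by move=> _ [u [Au Du] <-]; split=> //; apply: gD; exists u.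
  by apply: image_closure_sub => //; exists z.
- move=> clw; apply: Aw; apply: (@closureS _ (g @` (D `\` g @^-1` A))).
    by move=> _ [u [Du Au] <-]; split=> //; apply: gD; exists u.
  by apply: image_closure_sub => //; exists w.
Qed.

End retraction_chains.

(** * Inverse limits of continuous sequences of retractions *)

Lemma closed_eq_fun (Z X : topologicalType) (f g : Z -> X) :
  hausdorff_space X -> continuous f -> continuous g ->
  closed [set z | f z = g z].
Proof.
move=> hX cf cg z clz; apply: hX => A B nA nB.
have nAB : nbhs z (f @^-1` A `&` g @^-1` B).
  by apply: filterI; [exact: cf|exact: cg].
have [w [fgw [Aw Bw]]] := clz _ nAB.
by exists (f w); split=> //; rewrite fgw.
Qed.

Lemma compact_set_type (T : topologicalType) (A : set T) :
  compact A -> compact [set: set_type A].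
Proof.
move=> cA F FF _.
have FA : (set_val @ F) A.
  by rewrite /= /nbhs /=; apply: filterS filterT => x _; exact: set_valP.
have [x [Ax clx]] := cA (set_val @ F) _ FA.
exists (exist _ x (mem_set Ax)); split=> // B C FB.
rewrite nbhsE => -[D [[E oE <-] /= Ex] DC].
have FB' : (set_val @ F) (set_val @` B).
  by apply: (@filterS _ F _ B) => // b Bb; exists b.
have [y [[b Bb <-] Eb]] := clx _ _ FB' (open_nbhs_nbhs (conj oE Ex)).
by exists b; split=> //; exact: DC.
Qed.

Lemma hausdorff_set_type (T : topologicalType) (A : set T) :
  hausdorff_space T -> hausdorff_space (set_type A).
Proof.
move=> hT x y clxy; apply: val_inj; apply: hT => B C nB nC.
have [z [Bz Cz]] := clxy _ _ (initial_continuous nB) (initial_continuous nC).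
by exists (set_val z).
Qed.

Section well_orders.
Context (I : choiceType) (le : rel I).
Hypothesis wo : well_order le.

Lemma wo_total : total le.
Proof. by move=> i j; have /withinW/wo_chainW := wo; apply. Qed.

Lemma wo_refl : reflexive le.
Proof. by move=> i; have := wo_total i i; rewrite orbb. Qed.

Lemma wo_anti i j : le i j -> le j i -> i = j.
Proof.
by move=> ij ji; have /withinW/wo_chain_antisymmetric := wo; apply=> //; rewrite ij.
Qed.

Lemma wo_min (A : set I) : A !=set0 -> exists2 m, A m & forall i, A i -> le m i.
Proof.
move=> [a Aa]; have [|m [[mA mmin] _]] := wo (A := fun i => `[< A i >]).
  by exists a; exact/asboolP.
by exists m => [|i Ai]; [exact/asboolP|apply: mmin; exact/asboolP].
Qed.

Lemma wo_trans : transitive le.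
Proof.
move=> j i k ij jk.
have [|m [->|[->|->]] mmin] := @wo_min [set x | x = i \/ x = j \/ x = k].
- by exists i; left.
- by apply: mmin; right; right.
- have ji : le j i by apply: mmin; left.
  by rewrite (wo_anti ij ji).
- have kj : le k j by apply: mmin; right; left.
  by rewrite -(wo_anti jk kj).
Qed.

Lemma not_below i j : ~ below le j i -> le j i.
Proof.
move=> nij; case/orP: (wo_total j i) => // ij; case: (eqVneq i j) => [->|ij'].
  exact: wo_refl.
by case: nij; rewrite /below ij.
Qed.

Lemma below_trans i j k : le j k -> below le j i -> below le k i.
Proof.
move=> jk /andP[ij ij']; rewrite /below (wo_trans ij jk)/=.
by apply/eqP => ik; move/eqP: ij'; apply; apply: wo_anti => //; rewrite ik.
Qed.

Lemma wo_ind (P : I -> Prop) :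
  (forall k, (forall j, below le k j -> P j) -> P k) -> forall k, P k.
Proof.
move=> IH k; apply: contrapT => nPk.
have [|m nPm mmin] := @wo_min [set i | ~ P i]; first by exists k.
apply: nPm; apply: IH => j jm; apply: contrapT => /mmin mj.
by move/andP: jm => [jm /eqP]; apply; exact: wo_anti.
Qed.

Definition is_succ j k := below le k j /\ forall l, below le k l -> le l j.

Lemma wo_cases k :
  [\/ forall i, le k i, exists j, is_succ j k | limit_index le k].
Proof.
have [k0|/existsNP[i ki]] := pselect (forall i, le k i); first exact: Or31.
have [ex|nex] := pselect (exists j, is_succ j k); first exact: Or32.
apply: Or33; split.
  by exists i; apply: contrapT => /not_below.
move=> j jk; apply: contrapT => nj; apply: nex; exists j; split=> // l lk.
by apply: not_below => jl; apply: nj; exists l.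
Qed.

End well_orders.

Section inverse_limits.
Context (I : choiceType) (le : rel I) (S : inverse_system le).
Hypotheses (wo : well_order le) (S_cont : continuous_sequence S).
Hypothesis S_retr : forall (i j : I) (ij : le i j), retraction (bond S ij).
Hypotheses (S_compact : forall i, compact [set: S i])
  (S_hausdorff : forall i, hausdorff_space (S i)).

Let Z := inverse_limit S.
Let p (i : I) (z : Z) : S i := set_val z i.

Let p_cont i : continuous (p i).
Proof.
pose pr (x : prod_topology (fun i => S i)) : S i := x i.
suff : continuous (pr \o (set_val : Z -> prod_topology (fun i => S i))) by [].
move=> z; apply: continuous_comp; first exact: initial_continuous.
exact: (@proj_continuous I S i).
Qed.

Lemma hausdorff_inverse_limit : hausdorff_space Z.
Proof. by apply: hausdorff_set_type; exact: hausdorff_product. Qed.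

Lemma compact_inverse_limit : compact [set: Z].
Proof.
apply: compact_set_type.
apply: (subclosed_compact _ (tychonoff S_compact)) => //.
move=> x clx i j ij.
have : closed [set y : prod_topology (fun i => S i) | bond S ij (y j) = y i].
  apply: closed_eq_fun => //; last exact: (@proj_continuous I S i).
  move=> y; apply: (@continuous_comp _ _ _ (fun y : prod_topology (fun i => S i) => y j)).
    exact: (@proj_continuous I S j).
  exact: bond_continuous.
by apply; apply: closureS clx => y; apply.
Qed.

Let bond_p i j (ij : le i j) z : bond S ij (p j z) = p i z.
Proof. exact: (set_valP z). Qed.

Let p_inj z w : (forall i, p i z = p i w) -> z = w.
Proof. by move=> pzw; apply: val_inj; apply/functional_extensionality_dep. Qed.

Let limit_inj d (v w : S d) : limit_index le d ->
  (forall i (id : le i d), below le d i -> bond S id v = bond S id w) -> v = w.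
Proof.
move=> /S_cont[h [[_ [g [_ hK _]]] hE]] vw; rewrite -[v]hK -[w]hK; congr g.
apply: val_inj; apply/functional_extensionality_dep => i.
exact: (etrans (hE v i) (etrans (vw _ _ (valP i)) (esym (hE w i)))).
Qed.

Let t i j (ij : le i j) : S i -> S j := sval (cid (S_retr ij).2).
Let t_cont i j (ij : le i j) : continuous (t ij).
Proof. by have [] := svalP (cid (S_retr ij).2). Qed.
Let tK i j (ij : le i j) : cancel (t ij) (bond S ij).
Proof. by have [] := svalP (cid (S_retr ij).2). Qed.

(* The points of [S k] obtained from [u : S i] by applying, beyond [i], the
   chosen right inverses of the successor bonding maps. *)
Let extends i (u : S i) k (v : S k) :=
  [/\ forall ik : le i k, bond S ik v = u,
      forall ki : le k i, v = bond S ki u &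
      forall j l (jk : le j k) (lk : le l k) (jl : le j l), is_succ le j l ->
        le i j -> bond S lk v = t jl (bond S jk v)].

Let extends_bond i (u : S i) k (v : S k) j (jk : le j k) :
  extends u v -> extends u (bond S jk v).
Proof.
move=> [vu uv vt]; split.
- move=> ij; have ik := wo_trans wo ij jk.
  by rewrite (bond_comp ij jk ik).
- move=> ji; case/orP: (wo_total wo i k) => [ik|ki].
    by rewrite -(vu ik) (bond_comp ji ik jk).
  by rewrite (uv ki) (bond_comp jk ki ji).
- move=> a b aj bj ab sab ia; have ak := wo_trans wo aj jk.
  have bk := wo_trans wo bj jk.
  by rewrite (bond_comp bj jk bk) (bond_comp aj jk ak); exact: vt.
Qed.

Let below_le k j : below le k j -> le j k. Proof. by case/andP. Qed.

(** Up to [i] the value is a projection of [u]; beyond [i], successors are governed by [t] and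
    limits by continuity of the sequence. *)
Let extends_unique i (u : S i) k (v w : S k) :
  extends u v -> extends u w -> v = w.
Proof.
elim/(wo_ind wo): k => k IH in v w * => uv uw.
have [bki|/(not_below wo) ki] := pselect (below le k i); last first.
  by have [_ -> _] := uv; have [_ -> _] := uw.
have IHb j (jk : le j k) : below le k j -> bond S jk v = bond S jk w.
  by move=> bjk; apply: IH => //; exact: extends_bond.
have [k0|[j sjk]|lk] := wo_cases wo k.
- by have [_ uv2 _] := uv; have [_ uw2 _] := uw; rewrite (uv2 (k0 i)) (uw2 (k0 i)).
- have jk := below_le sjk.1; have kk := wo_refl wo k.
  have [_ _ /(_ j k jk kk jk sjk (sjk.2 _ bki))] := uv; rewrite bond_id => ->.
  have [_ _ /(_ j k jk kk jk sjk (sjk.2 _ bki))] := uw; rewrite bond_id => ->.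
  by rewrite IHb//; exact: sjk.1.
- by apply: limit_inj lk _ => j jk; exact: IHb.
Qed.

Let below_not_le k j : below le k j -> le k j -> False.
Proof. by move=> /andP[jk /eqP nkj] /(wo_anti wo jk). Qed.

Let extends_exists i (u : S i) k : exists v : S k, extends u v.
Proof.
elim/(wo_ind wo): k => k IH.
have [bki|/(not_below wo) ki] := pselect (below le k i); last first.
  exists (bond S ki u); split.
  - by move=> ik; rewrite (bond_comp ik ki (wo_refl wo i)) bond_id.
  - by move=> ki'; rewrite (bool_irrelevance ki ki').
  - move=> j l jk lk jl sjl ij; have := wo_trans wo lk (wo_trans wo ki ij).
    by move=> /(below_not_le sjl.1).
have ik := below_le bki.
have [k0|[j sjk]|lk] := wo_cases wo k.
- by case: (below_not_le bki (k0 i)).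
- have jk := below_le sjk.1; have ij := sjk.2 _ bki.
  have [w [w1 w2 w3]] := IH _ sjk.1; exists (t jk w); split.
  + by move=> ik'; rewrite -(bond_comp ij jk ik') tK.
  + by move=> ki; case: (below_not_le bki ki).
  + move=> a b ak bk ab sab ia; have [bk'|nbk] := eqVneq b k.
      subst b; have aj : a = j.
        by apply: (wo_anti wo); [exact: sjk.2 sab.1|exact: sab.2 sjk.1].
      subst a; rewrite bond_id (bool_irrelevance ak jk) tK.
      by rewrite (bool_irrelevance ab jk).
    have bj : le b j by apply: sjk.2; rewrite /below bk.
    have aj := wo_trans wo ab bj.
    by rewrite -(bond_comp bj jk bk) -(bond_comp aj jk ak) tK; exact: w3.
- have [h [[_ [g [_ _ gK]]] hE]] := S_cont lk.
  (* The values below a limit are chosen independently; uniqueness makes them a thread. *)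
  pose y (s : segment le k) : S (val s) := sval (cid (IH (val s) (valP s))).
  have yP (s : segment le k) : extends u (y s) := svalP (cid (IH (val s) (valP s))).
  have yS : threads (Defs.restrict S k) y.
    move=> a b ab /=; apply: (@extends_unique _ u); last exact: yP.
    by apply: extends_bond; exact: yP.
  pose v := g (exist _ y (mem_set yS)).
  have vE s : bond S (segment_leP s) v = y s by rewrite -hE gK.
  have vE' b (bk : le b k) (bbk : below le k b) :
      bond S bk v = y (Sub b bbk : segment le k).
    by rewrite -vE; congr (bond S _ _); exact: bool_irrelevance.
  exists v; split.
  + move=> ik'; rewrite vE'; have [+ _ _] := yP (Sub i bki : segment le k).
    by move=> /(_ (wo_refl wo i)); rewrite bond_id.
  + by move=> ki; case: (below_not_le bki ki).
  + move=> a b ak bk ab sab ia; have [bk'|nbk] := eqVneq b k.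
      subst b; have [j [jk aj]] := lk.2 _ sab.1.
      by case: (below_not_le aj (sab.2 _ jk)).
    have bbk : below le k b by rewrite /below bk.
    have [_ _ /(_ a b ab (wo_refl wo b) ab sab ia)] := yP (Sub b bbk : segment le k).
    by rewrite bond_id -(bond_comp ab bk ak) !vE'.
Qed.

Let ext i (u : S i) k := sval (cid (extends_exists u k)).
Let extP i (u : S i) k : extends u (ext u k) := svalP (cid (extends_exists u k)).

Let ext_threads i (u : S i) : threads S (ext u).
Proof.
move=> a b ab; apply: (@extends_unique _ u); last exact: extP.
by apply: extends_bond; exact: extP.
Qed.

Let s i (u : S i) : Z :=
  exist _ (ext u : prod_topology (fun i => S i)) (mem_set (@ext_threads i u)).

Let psK i : cancel (@s i) (p i).
Proof.
by move=> u; have [/(_ (wo_refl wo i)) + _ _] := extP u i; rewrite bond_id.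
Qed.

(* The copy of [S i] inside the limit: these sets increase with [i]. *)
Let Y i := [set z : Z | forall j l (jl : le j l), is_succ le j l -> le i j ->
  p l z = t jl (p j z)].

Let Y_s i u : Y i (@s i u).
Proof.
move=> j l jl sjl ij; have [_ _ /(_ j l jl (wo_refl wo l) jl sjl ij)] := extP u l.
rewrite bond_id => e; exact: (etrans e (congr1 _ (ext_threads u jl))).
Qed.

Let s_unique i u z : Y i z -> p i z = u -> z = @s i u.
Proof.
move=> Yz pz; apply: p_inj => k; apply: (@extends_unique _ u); last exact: extP.
split.
- by move=> ik; rewrite bond_p.
- by move=> ki; rewrite -pz bond_p.
- by move=> j l jk lk jl sjl ij; rewrite !bond_p; exact: Yz.
Qed.

Let Y_closed i : closed (Y i).
Proof.
move=> z clz j l jl sjl ij.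
have : closed [set z | p l z = t jl (p j z)].
  apply: closed_eq_fun => // w.
  by apply: continuous_comp; [exact: p_cont|exact: t_cont].
by apply; apply: closureS clz => w; exact.
Qed.

(** Cluster points of the values near [u] lie in the closed set [Y i] and project to [u], hence
    equal [s u]; compactness of the limit does the rest. *)
Let s_cont i : continuous (@s i).
Proof.
move=> u; apply: compact_cvg_unique_cluster.
- exact: hausdorff_inverse_limit.
- exact: compact_inverse_limit.
move=> z clz; apply: s_unique.
  apply: (cluster_closed (Y_closed (i := i)) _ clz).
  by apply: (@filterS _ (nbhs u) _ setT) => [v _|]; [exact: Y_s|exact: filterT].
apply: (cluster_cvg_image (S_hausdorff (i := i)) (p_cont (i := i) (x := z)) clz).
by move=> V nV; apply: (@filterS _ (nbhs u) _ V) => // v Vv /=; rewrite psK.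
Qed.

Lemma club_separated_inverse_limit (X : topologicalType) (f : Z -> X) :
  hausdorff_space X -> countably_tight X -> continuous f ->
  (forall i (g : S i -> X), continuous g -> club_separated (range g)) ->
  club_separated (range f).
Proof.
move=> hX tX cf sepS.
apply: (@club_separated_chain _ _ _ le (fun i => @s i \o p i)) => //.
- exact: compact_inverse_limit.
- exact: hausdorff_inverse_limit.
- exact: wo_total.
- exact: wo_trans.
- by move=> i z; apply: continuous_comp; [exact: p_cont|exact: s_cont].
- by move=> i j z ij /=; rewrite -[in LHS](bond_p ij) psK bond_p.
(* Injectivity on the closure, by induction on the coordinate [k]. If no index of [J] reaches [k]
   and [k] succeeds [l], both points lie in the closed set [Y l], so coordinate [l] determines
   coordinate [k]; at limits continuity applies. *)
- move=> J z w Jz Jw pzw.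
  have {}pzw j : J j -> p j z = p j w.
    by move=> /pzw /(congr1 (p j)) /=; rewrite !psK.
  apply: p_inj; apply: (wo_ind wo) => k IH.
  have [[j [Jj kj]]|nJ] := pselect (exists j, J j /\ le k j).
    by rewrite -!(bond_p kj) pzw.
  have Jk j : J j -> below le k j.
    by move=> Jj; apply: contrapT => /(not_below wo) kj; apply: nJ; exists j.
  have [j0 Jj0] : J !=set0.
    by have [_ [[j Jj _] _]] := Jz setT filterT; exists j.
  have [k0|[l slk]|lk] := wo_cases wo k.
  + by case: (below_not_le (Jk _ Jj0) (k0 j0)).
  + have JY x : closure (\bigcup_(j in J) range (@s j \o p j)) x -> Y l x.
      rewrite [X in _ -> X](_ : _ = closure (Y l) x); last first.
        by rewrite -(closure_id _).1//; exact: Y_closed.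
      apply: closureS => _ [j Jj [y _ <-]] a b ab sab la.
      exact: (@Y_s j (p j y) a b ab sab (wo_trans wo (slk.2 _ (Jk _ Jj)) la)).
    have lk' := below_le slk.1.
    rewrite (JY _ Jz l k lk' slk (wo_refl wo l)) (JY _ Jw l k lk' slk (wo_refl wo l)).
    by rewrite IH//; exact: slk.1.
  + by apply: limit_inj lk _ => j jk bjk; rewrite !bond_p; exact: IH.
- by move=> z w rzw; apply: p_inj => i; rewrite -[LHS]psK -[RHS]psK; exact/congr1/rzw.
- move=> i; have -> : range (f \o (@s i \o p i)) = range (f \o @s i).
    rewrite eqEsubset; split=> _ [z _ <-]; first by exists (p i z).
    by exists (s z) => //=; rewrite psK.
  by apply: sepS => u; apply: continuous_comp; [exact: s_cont|exact: cf].
Qed.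

End inverse_limits.

(** * Retractions onto closures of coded points *)

(** For each [n], the sets on which all members of [L] stay within 1/(n+1) of their value at a
    centre cover [X]; by compactness countably many centres suffice. *)
Lemma countable_net (R : realType) (X : topologicalType) (L : seq (X -> R)) :
  compact [set: X] -> (forall h, h \in L -> continuous h) ->
  exists Q : set X, countable Q /\ forall x n,
    exists2 u, Q u & forall h, h \in L -> `|h u - h x| < n.+1%:R^-1.
Proof.
move=> cX cL.
suff net n : exists Q : set X, countable Q /\ forall x, True ->
    exists2 u, Q u & forall h, h \in L -> `|h u - h x| < n.+1%:R^-1.
  exists (\bigcup_n sval (cid (net n))); split.
    by apply: bigcup_countable => // n _; case: (svalP (cid (net n))).
  move=> x n; have [_ /(_ x Logic.I)[u Qu uP]] := svalP (cid (net n)).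
  by exists u => //; exists n.
apply: (@compact_set_ind _ setT (fun V => exists Q : set X, countable Q /\
   forall x, V x -> exists2 u, Q u & forall h, h \in L -> _)) => //.
- by exists set0.
- move=> U V [Q [cQ QU]] [Q' [cQ' QV]]; exists (Q `|` Q'); split.
    exact: countableU.
  by move=> x [/QU|/QV] [u Qu uP]; exists u => //; [left|right].
- by move=> U V UV [Q [cQ QV]]; exists Q; split=> // x /UV/QV.
- move=> x _.
  suff : nbhs x [set y | forall h, h \in L -> `|h x - h y| < n.+1%:R^-1].
    by move=> nx; eexists; first exact: nx; exists [set x]; split=> // y yP; exists x.
  elim: L cL => [|h L IH] cL; first by apply: filterS filterT.
  have nh : nbhs x [set y | `|h x - h y| < n.+1%:R^-1].
    have ch : h y @[y --> x] --> h x by apply: cL; exact: mem_head.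
    by move/cvgrPdist_lt : ch; apply; rewrite invr_gt0 ltr0n.
  have nL := IH (fun k kL => cL k (@mem_behead _ (h :: L) k kL)).
  apply: filterS (filterI nh nL) => y [hy Ly] k; rewrite inE => /orP[/eqP->//|].
  exact: Ly.
Qed.

(** Coded by two sets, so functions need no codes of their own. It is continuous even when the
    closures meet. *)
Definition urysohn_fun (R : realType) (X : topologicalType) (B B' : set X) :
  X -> R := Urysohn (closure B) (closure B').

Definition functions_of (R : realType) (X : topologicalType) (H : Type)
    (M : set (univ X H)) : set (X -> R) :=
  [set h | exists B B', [/\ M (St H B), M (St H B') & h = urysohn_fun R B B']].

Lemma functions_of_cont (R : realType) (X : topologicalType) (H : Type)
    (M : set (univ X H)) (h : X -> R) : functions_of M h -> continuous h.
Proof. by move=> [B [B' [_ _ ->]]]; exact: Urysohn_continuous. Qed.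

Lemma functions_ofS (R : realType) (X : topologicalType) (H : Type)
    (M N : set (univ X H)) : M `<=` N ->
  @functions_of R X H M `<=` functions_of N.
Proof. by move=> MN h [B [B' [/MN ? /MN ? ->]]]; exists B, B'. Qed.

(* The functions with codes in [M] turn [closure (trace setT M)] into a
   retract of [X]. *)
Definition retract_code (R : realType) (X : topologicalType) (H : Type)
    (M : set (univ X H)) :=
  (forall x y, closure (trace setT M) x -> closure (trace setT M) y ->
    (forall h : X -> R, functions_of M h -> h x = h y) -> x = y) /\
  forall x, exists2 y, closure (trace setT M) y
    & forall h : X -> R, functions_of M h -> h y = h x.

Section retract_codes.
Context (R : realType) (X : topologicalType).
Hypotheses (cX : compact [set: X]) (hX : hausdorff_space X).
Hypothesis tX : countably_tight X.

Let urysohn_separates (B B' : set X) x y :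
  closure B `&` closure B' = set0 -> closure B x -> closure B' y ->
  urysohn_fun R B B' x <> urysohn_fun R B B' y.
Proof.
move=> BB' Bx By.
have sep : uniform_separator (closure B) (closure B').
  by apply: (@normal_separatorP R X).1 => //;
    [exact: compact_normal|exact: closed_closure|exact: closed_closure].
have -> : urysohn_fun R B B' x = 0 by apply: (Urysohn_sub0 sep); exists x.
have -> : urysohn_fun R B B' y = 1 by apply: (Urysohn_sub1 sep); exists y.
by apply/eqP; rewrite eq_sym oner_eq0.
Qed.

Let tight_witness (B : set X) u : exists C : set X,
  countable C /\ (closure B u -> C `<=` B /\ closure C u).
Proof.
have [/tX[C [CB cC Cu]]|nB] := pselect (closure B u); first by exists C.
by exists set0.
Qed.

(** Besides the lattice operations, this picks a common point of two closures, and the points of a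
    countable tightness witness for a point in the closure of a set. *)
Let lat (H : Type) (h k : univ X H) : set (univ X H) :=
  match h, k with
  | St B, St B' => [set St H (B `|` B'); St H (B `&` B')] `|`
      (@Pt X H @` pick1 (closure B `&` closure B'))
  | St B, Pt u => @Pt X H @` sval (cid (tight_witness B u))
  | _, _ => set0 end.

Let compl (H : Type) (h : univ X H) : set (univ X H) :=
  if h is St B then [set St H (~` B)] else set0.

(** For disjoint open neighbourhoods of [x] and [y], coded sets [B] and [B'] are found whose traces
    have closures inside them. If the full closures met, a coded point would lie in both; by
    tightness it would lie in the closures of both traces, a contradiction. So the Urysohn function
    of [B] and [B'] separates. *)
Let club_functions_separate (H : Type) :
  club (fun M : set (univ X H) => forall x y, x <> y ->
    closure (trace setT M) x -> closure (trace setT M) y ->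
    exists A, [/\ M (St H A), ~ closure (A `&` trace setT M) x
      & ~ closure (trace setT M `\` A) y]) ->
  club (fun M : set (univ X H) => forall x y,
    closure (trace setT M) x -> closure (trace setT M) y ->
    (forall h : X -> R, functions_of M h -> h x = h y) -> x = y).
Proof.
move=> clX.
have latc h k : countable (@lat H h k).
  case: h => [//|B|//]; case: k => [u|B'|//] /=.
    by apply: countable_image; case: (svalP (cid (tight_witness B u))).
  by apply: countableU; [apply: countableU|exact/countable_image/countable_pick1].
have complc h : countable (@compl H h) by case: h => [?|?|?] /=.
have cl0 : club (fun M : set (univ X H) => [set St H set0; St H setT] `<=` M).
  by apply: club_const; exact: countableU.
have := club_and (club_and clX cl0) (club_and (club_op1 complc) (club_op2 latc)).
apply: club_imp => M [[MX M0] [M1 M2]] x y; set E := trace setT M => Ex Ey hxy.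
apply: contrapT => /eqP xy.
have near z (W : set X) : closure E z -> open W -> W z ->
    exists2 B, M (St H B) & closure (B `&` E) z /\ closure (B `&` E) `<=` W.
  move=> Ez Wo Wz.
  have [|||||||A [MA Az AW]] := @lattice_separation _ [set A | M (St H A)] E
      [set z] (closure E `\` W).
  - exact: compact_set1.
  - apply: (subclosed_compact _ cX) => //; apply: closedI.
      exact: closed_closure.
    exact: open_closedC.
  - by apply: M0; left.
  - by apply: M0; right.
  - by move=> A B MA MB; apply: (M2 _ _ MA MB); left; left.
  - by move=> A B MA MB; apply: (M2 _ _ MA MB); left; right.
  - move=> _ w -> [Ew nWw]; apply: MX => // zw.
    by apply: nWw; rewrite -zw.
  exists (~` A); first exact: (M1 _ MA).
  rewrite setIC -setDE; split=> [|w clw].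
    have : closure (A `&` E `|` (E `\` A)) z by rewrite setIC setUIDK.
    by rewrite closureU => -[/(Az z erefl)|].
  apply: contrapT => nW; apply: (AW w) => //; split=> //.
  by apply: closureS clw; exact: subDsetl.
have [[W W'] /= [/set_mem Wx /set_mem Wy] [Wo Wo' /eqP WW']] :
    exists2 AB : set X * set X, x \in AB.1 /\ y \in AB.2 &
      [/\ open AB.1, open AB.2 & AB.1 `&` AB.2 == set0].
  by move: hX; rewrite open_hausdorff; apply.
have [B MB [Bx BW]] := near _ _ Ex Wo Wx.
have [B' MB' [By BW']] := near _ _ Ey Wo' Wy.
have tr A u : M (St H A) -> M (Pt H u) -> closure A u -> closure (A `&` E) u.
  move=> MA Mu Au.
  have MC := M2 _ _ MA Mu; rewrite /= in MC.
  have [_ /(_ Au)[CA]] := svalP (cid (tight_witness A u)).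
  apply: closureS => v Cv; split; first exact: CA.
  by split=> //; apply: MC; exists v.
apply: (@urysohn_separates B B' x y).
- rewrite -subset0 => v Bv; have [u u1] := pick1_ex Bv.
  have Mu : M (Pt H u) by apply: (M2 _ _ MB MB'); right; exists u.
  have [Bu B'u] := pick1_sub u1.
  have : (W `&` W') u by split; [exact/BW/tr|exact/BW'/tr].
  by rewrite WW'.
- by apply: closureS Bx; exact: subIsetl.
- by apply: closureS By; exact: subIsetl.
- by apply: hxy; exists B, B'.
Qed.

(** Decodes a list of codes, read in pairs of sets, so that a finitary operation can depend on a
    finite list of functions. *)
Let funs (H : Type) := fix funs (s : seq (univ X H)) : seq (X -> R) :=
  match s with
  | St B :: St B' :: s' => urysohn_fun R B B' :: funs s'
  | _ => [::] end.

Let funs_cont (H : Type) n (s : seq (univ X H)) : (size s <= n)%N ->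
  forall h, h \in funs s -> continuous h.
Proof.
elim: n s => [|n IH] [|[u|B|k] [|[u'|B'|k'] s]] //= sn h.
rewrite inE => /orP[/eqP->|]; first exact: Urysohn_continuous.
by apply: IH; exact: ltnW.
Qed.

Let funs_codes (H : Type) (M : set (univ X H)) (L : seq (X -> R)) :
  (forall h, h \in L -> functions_of M h) ->
  exists s, all (fun h => h \in M) s /\ funs s = L.
Proof.
elim: L => [|h L IH] ML; first by exists [::].
have [s [Ms <-]] := IH (fun k kL => ML k (@mem_behead _ (h :: L) k kL)).
have [B [B' [MB MB' ->]]] := ML h (mem_head _ _).
by exists (St H B :: St H B' :: s); rewrite /= !mem_set.
Qed.

(** If [x] had no counterpart, compactness would give finitely many coded functions and an [n] such
    that every point of the closure differs from [x] by at least 1/(n+1) on one of them. The net of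
    these functions, contained in [M], has a closer point. *)
Let club_functions_onto (H : Type) :
  club (fun M : set (univ X H) => forall x, exists2 y, closure (trace setT M) y
    & forall h : X -> R, functions_of M h -> h y = h x).
Proof.
have net (s : seq (univ X H)) := countable_net cX (funs_cont (leqnn (size s))).
have := @club_closed_under _ (fun s => @Pt X H @` sval (cid (net s))).
have netc s : countable (@Pt X H @` sval (cid (net s))).
  by apply: countable_image; case: (svalP (cid (net s))).
move=> /(_ netc); apply: club_imp => M cM x; apply: contrapT => nex.
pose Q (V : set X) := exists (L : seq (X -> R)) n,
  (forall h, h \in L -> functions_of M h) /\
  forall y, V y -> exists2 h, h \in L & n.+1%:R^-1 <= `|h y - h x|.
have : Q (closure (trace setT M)).
  apply: compact_set_ind.
  - by apply: (subclosed_compact _ cX) => //; exact: closed_closure.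
  - by exists [::], 0%N; split.
  - move=> U V [L [n [ML LU]]] [L' [n' [ML' LV]]].
    have le_inv (a b : nat) : (a <= b)%N -> b.+1%:R^-1 <= a.+1%:R^-1 :> R.
      by move=> ab; rewrite lef_pV2 ?posrE ?ltr0n// ler_nat.
    exists (L ++ L'), (maxn n n'); split.
      by move=> h; rewrite mem_cat => /orP[/ML|/ML'].
    move=> y [/LU|/LV] [h hL hn]; exists h; rewrite ?mem_cat ?hL ?orbT//.
      by apply: le_trans hn; apply: le_inv; exact: leq_maxl.
    by apply: le_trans hn; apply: le_inv; exact: leq_maxr.
  - by move=> U V UV [L [n [ML LV]]]; exists L, n; split=> // y /UV/LV.
  - move=> y Ey.
    have [h Mh hyx] : exists2 h : X -> R, functions_of M h & h y <> h x.
      apply: contrapT => nh; apply: nex; exists y => // h Mh.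
      by apply: contrapT => hyx; apply: nh; exists h.
    pose d := `|h y - h x|.
    have d0 : 0 < d by rewrite normr_gt0 subr_eq0; exact/eqP.
    have [n nd] : exists n : nat, n.+1%:R^-1 < d / 2.
      have [//|n] := @ltr_add_invr R 0 (d / 2); first by rewrite divr_gt0.
      by rewrite add0r; exists n.
    exists [set z | `|h y - h z| < d / 2].
      have hc : h z @[z --> y] --> h y by exact: (functions_of_cont Mh).
      by move/cvgrPdist_lt : hc; apply; rewrite divr_gt0.
    exists [:: h], n; split; first by move=> k; rewrite inE => /eqP->.
    move=> z /= hz; exists h; first exact: mem_head.
    have := ler_distD (h z) (h y) (h x); rewrite -/d => dle.
    apply: ltW; apply: lt_le_trans nd _.
    by rewrite -(lerD2l (d / 2)) -splitr (le_trans dle)// lerD2r ltW.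
move=> [L [n [ML LP]]]; have [s [Ms sL]] := funs_codes ML.
have [_ /(_ x n)[u Qu uP]] := svalP (cid (net s)).
have Eu : trace setT M u by split=> //; apply: (cM s Ms); exists u.
have [h hL] := LP u (subset_closure Eu).
by rewrite leNgt uP// sL.
Qed.

Lemma club_retract_code : club_separated [set: X] ->
  exists H : Type, club (@retract_code R X H).
Proof.
move=> [H clH]; exists H.
exact: club_and (club_functions_separate clH) (club_functions_onto H).
Qed.

End retract_codes.

(** * Point-countable separating families *)

Definition sigma_family (R : realType) (X : topologicalType) (Y : set X)
    (F : set (X -> R)) :=
  [/\ forall h, F h -> continuous h /\ forall x, 0 <= h x <= 1,
      forall x, Y x -> countable [set h | F h /\ h x <> 0] &
      forall x y, Y x -> Y y -> (forall h, F h -> h x = h y) -> x = y].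

Section retract_decomposition.
Context (R : realType) (X : topologicalType) (H : Type).
Hypotheses (cX : compact [set: X]) (hX : hausdorff_space X).
Hypothesis tX : countably_tight X.

Let U := {classic univ X H}.

Context (c : seq U -> set U) (le : rel U).
Hypothesis c_countable : forall s, countable (c s).
Hypothesis c_retract : forall M, closed_under c M -> retract_code R M.
Hypothesis wo : well_order le.

Implicit Types (M N C D : set U).

Let E M : set X := closure (trace setT M).

(** The default [x] is never taken when [M] is closed under [c]; the value is then unique by
    [retract_code]. *)
Let r M x := xget x [set y | E M y /\
  forall h : X -> R, functions_of M h -> h y = h x].

Let rP M x : closed_under c M ->
  E M (r M x) /\ forall h : X -> R, functions_of M h -> h (r M x) = h x.
Proof.
move=> /c_retract[_ /(_ x)[y Ey hy]].
by apply: (@xgetI _ x [set y | E M y /\ _] y).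
Qed.

Let r_eq M x y : closed_under c M -> E M y ->
  (forall h : X -> R, functions_of M h -> h y = h x) -> r M x = y.
Proof.
move=> cM Ey hy; have [Er hr] := rP x cM.
by apply: (c_retract cM).1 => // h Mh; rewrite hr// hy.
Qed.

Let ES M N : M `<=` N -> E M `<=` E N.
Proof. by move=> MN; apply: closureS => x [_ /MN]. Qed.

Let r_cont M : closed_under c M -> continuous (r M).
Proof.
move=> cM x; apply: compact_cvg_unique_cluster => // y cly.
apply/esym/r_eq => //.
  rewrite /E; apply: (cluster_closed _ _ cly); first exact: closed_closure.
  by apply: (@filterS _ (nbhs x) _ setT) => [z _|]; [exact: (rP z cM).1|exact: filterT].
move=> h Mh; have ch := functions_of_cont Mh.
apply: (cluster_cvg_image (@Rhausdorff R) (ch y) cly).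
move=> V nV; apply: (@filterS _ (nbhs x) _ (h @^-1` V)); last exact: ch.
by move=> z /= Vz; rewrite (rP z cM).2.
Qed.

Let seg (a : U) : set U := [set b | below le a b].

(** The models just before and just after [a] is added. The countable parameter set [C] makes the
    later model an instance of the earlier one, with [a] added to the parameters. *)
Let cseg C a := hull c (seg a `|` C).
Let cseg1 C a := hull c (seg a `|` (C `|` [set a])).

Let closed_cseg C a : closed_under c (cseg C a). Proof. exact: hull_closed. Qed.
Let closed_cseg1 C a : closed_under c (cseg1 C a). Proof. exact: hull_closed. Qed.

Let cseg_sub1 C a : cseg C a `<=` cseg1 C a.
Proof. by apply: hullS; apply: setUS; exact: subsetUl. Qed.

Let base_sub C a : hull c C `<=` cseg C a.
Proof. by apply: hullS; exact: subsetUr. Qed.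

Let cseg1_sub C a b : below le b a -> cseg1 C a `<=` cseg C b.
Proof.
move=> ab; apply: hullS => h [ha|[Ch|->]]; [left|by right|by left].
by apply: (below_trans wo _ ha); case/andP: ab.
Qed.

Let cseg1_mono C a b : le a b -> cseg1 C a `<=` cseg1 C b.
Proof.
move=> ab; have [->//|nab] := eqVneq a b.
apply: (subset_trans _ (@cseg_sub1 C b)).
by apply: cseg1_sub; rewrite /below ab.
Qed.

Let cseg_mono C a b : le a b -> cseg C a `<=` cseg C b.
Proof.
move=> ab; apply: hullS => h [ha|Ch]; [left|by right].
exact: (below_trans wo ab).
Qed.

Definition downset D := forall a, D a -> seg a `<=` D.

Let cseg1_subD C D a : downset D -> D a -> cseg1 C a `<=` hull c (D `|` C).
Proof.
move=> dD Da; apply: hullS => h [/(dD _ Da)|[Ch|->]]; by [left|right|left].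
Qed.

(** The models [cseg1 C a] with [a] in [D], together with [hull c C] to cover empty [D], form a
    chain; its union is closed under [c]. *)
Let hull_split C D h : hull c (D `|` C) h ->
  hull c C h \/ exists2 a, D a & cseg1 C a h.
Proof.
pose F (o : option {a | D a}) :=
  if o is Some s then cseg1 C (proj1_sig s) else hull c C.
have F0 a : hull c C `<=` cseg1 C a.
  exact: (subset_trans (@base_sub C a)).
have Fchain o o' : F o `<=` F o' \/ F o' `<=` F o.
  case: o o' => [[a Da]|] [[b Db]|] /=; [|by right|by left|by left].
  by case/orP: (wo_total wo a b) => [/cseg1_mono|/cseg1_mono]; [left|right].
have cF o : closed_under c (F o) by case: o => [s|]; exact: hull_closed.
have FD : D `|` C `<=` \bigcup_o F o.
  move=> k [Dk|Ck]; last by exists None => //; exact: hull_sub.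
  exists (Some (exist _ k Dk)) => //=.
  by apply: hull_sub; right; right.
move=> /(_ _ (closed_under_bigcup_chain None Fchain cF) FD)[[[a Da]|] _ Fh].
  by right; exists a.
by left.
Qed.

Let jumps C D x := [set a | D a /\ r (cseg1 C a) x <> r (cseg C a) x].

(* A minimal initial segment with uncountably many jumps has uncountable
   cofinality, so by tightness [r] is already constant before its end. *)
Let countable_jumps C D x : downset D -> countable (jumps C D x).
Proof.
move=> dD; apply: contrapT => ncJ.
have [D' [dD' D'D ncJ' cJ']] : exists D', [/\ downset D', D' `<=` D,
    ~ countable (jumps C D' x) & forall a, D' a -> countable (jumps C (seg a) x)].
  have [ex|nex] := pselect (exists a, D a /\ ~ countable (jumps C (seg a) x)).
    have [a [Da nca] amin] := wo_min wo ex.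
    exists (seg a); split => //; last first.
    - move=> b ba; apply: contrapT => ncb; have ab : le a b.
        by apply: amin; split=> //; exact: (dD a).
      by case/andP: ba => [ba /eqP]; apply; exact: (wo_anti wo).
    - exact: dD.
    - by move=> b ba d; apply: (below_trans wo); case/andP: ba.
  by exists D; split=> // a Da; apply: contrapT => nca; apply: nex; exists a.
have [a0 Da0] : D' !=set0.
  apply/set0P/eqP => D0; apply: ncJ'; apply: (@sub_countable _ _ _ (set0 : set U)) => //.
  by apply: subset_card_le => a []; rewrite D0.
pose M := hull c (D' `|` C).
have cM : closed_under c M by exact: hull_closed.
have [Ex hx] := rP x cM; have [B [BM cB Bx]] := tX Ex.
have /choice[b bP] y : exists b, B y -> D' b /\ cseg1 C b (Pt H y).
  have [By|nB] := pselect (B y); last by exists a0.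
  have [_ /hull_split[My|[a Da My]]] := BM _ By; last by exists a.
  by exists a0 => _; split=> //; apply: cseg_sub1; exact: base_sub.
(* Otherwise each element of [D'] would be at or below some [b y], and countably many countable sets
   would cover the jumps. *)
have [g D'g gB] : exists2 g, D' g & forall y, B y -> below le g (b y).
  apply: contrapT => ng; apply: ncJ'.
  apply: (@sub_countable _ _ _ (\bigcup_(y in B) (jumps C (seg (b y)) x `|` [set b y]))).
    apply: subset_card_le => a [D'a ja].
    have /existsNP[y /not_implyP[By nay]] : ~ forall y, B y -> below le a (b y).
      by move=> ay; apply: ng; exists a.
    exists y => //; have [->|nab] := eqVneq a (b y); first by right.
    by left; split=> //; rewrite /seg /= /below (not_below wo nay).
  apply: bigcup_countable => // y By; apply: countableU => //.
  by apply: cJ'; case: (bP _ By).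
(* All of [B] is coded before [g], so from [g] on both retractions at each stage in [D'] send [x] to
   [r M x]. *)
have Eg : E (cseg C g) (r M x).
  apply: closureS Bx => y By; split=> //.
  by apply: (@cseg1_sub C (b y)); [exact: gB|case: (bP _ By)].
apply: ncJ'; apply: sub_countable (cJ' _ D'g); apply: subset_card_le => a [D'a ja].
split=> //; apply: contrapT => /(not_below wo) ga; apply: ja.
have aM : cseg1 C a `<=` M by exact: cseg1_subD.
rewrite (@r_eq (cseg1 C a) _ (r M x))//.
- apply/esym/r_eq => //; first exact: (ES (cseg_mono ga)).
  move=> h /(functions_ofS (subset_trans (@cseg_sub1 C a) aM)); exact: hx.
- apply: ES Eg; apply: (subset_trans (cseg_mono ga)); exact: cseg_sub1.
- by move=> h /(functions_ofS aM); exact: hx.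
Qed.

(** The positive part keeps the values in [0,1]; using both orders of [f] and [g] recovers the
    signed difference. *)
Let diff (f g : X -> X) (h : X -> R) : X -> R :=
  fun x => Num.max (h (f x) - h (g x)) 0.

Let claim D := forall C, countable C ->
  exists F : set (X -> R), sigma_family (E (hull c (D `|` C))) F.

(** The family consists of the countably many functions of [hull c C] and the differences of members
    of [F a] along the two retractions at [a]. At a given point the latter vanish unless [a] is one
    of countably many jumps, and there all but countably many vanish. *)
Let claim_step D : downset D -> (forall a, D a -> claim (seg a)) -> claim D.
Proof.
move=> dD IH C cC.
have /choice[F FP] a : exists F : set (X -> R),
    D a -> sigma_family (E (cseg1 C a)) F.
  have [Da|nD] := pselect (D a); last by exists set0.
  by have [F sF] := IH a Da (C `|` [set a]) (countableU cC (countable1 a)); exists F.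
pose f a := r (cseg1 C a); pose g a := r (cseg C a).
have Ef a x : E (cseg1 C a) (f a x) by exact: (rP x (@closed_cseg1 C a)).1.
have Eg a x : E (cseg1 C a) (g a x).
  by apply: (ES (@cseg_sub1 C a)); exact: (rP x (@closed_cseg C a)).1.
pose G a h := [set diff (f a) (g a) h; diff (g a) (f a) h].
pose F0 : set (X -> R) := functions_of (hull c C).
exists (F0 `|` [set k | exists a h, [/\ D a, F a h & G a h k]]); split.
- have diffP (f' g' : X -> X) (h : X -> R) :
      continuous f' -> continuous g' -> continuous h ->
      (forall x, 0 <= h x <= 1) ->
      continuous (diff f' g' h) /\ forall x, 0 <= diff f' g' h x <= 1.
    move=> cf' cg' ch h01; split=> x.
      apply: (@continuous_max _ _ (fun x => h (f' x) - h (g' x)) (fun=> 0)).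
        apply: (@continuousB R R^o X (h \o f') (h \o g')); apply: continuous_comp;
          by [exact: cf'|exact: cg'|exact: ch].
      exact: cvg_cst.
    rewrite /diff le_max lexx orbT/= ge_max ler01 andbT.
    have /andP[_ h1] := h01 (f' x); have /andP[h0 _] := h01 (g' x).
    by rewrite lerBlDr (le_trans h1)// lerDl.
  move=> k [Fk|[a [h [Da Fh Gk]]]].
    split; first exact: (functions_of_cont Fk).
    move: Fk => [B [B' [_ _ ->]]] x.
    have /Urysohn_range : range (urysohn_fun R B B') (urysohn_fun R B B' x) by exists x.
    by rewrite /= in_itv.
  have [/(_ _ Fh)[ch h01] _ _] := FP a Da.
  have cf : continuous (f a) by exact: r_cont.
  have cg : continuous (g a) by exact: r_cont.
  by case: Gk => ->; exact: diffP.
- move=> x Ex.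
  pose K a := [set h | F a h /\ h (f a x) <> 0] `|` [set h | F a h /\ h (g a x) <> 0].
  apply: (@sub_countable _ _ _ (F0 `|`
      \bigcup_(a in jumps C D x) \bigcup_(h in K a) G a h)).
    apply: subset_card_le => k [[F0k|[a [h [Da Fh Gk]]]] kx]; first by left.
    have hfg : h (f a x) <> h (g a x).
      by move=> e; apply: kx; case: Gk => ->; rewrite /diff e subrr maxxx.
    right; exists a; first by split=> // e; apply: hfg; rewrite /f e.
    exists h => //; have [e|nz] := eqVneq (h (f a x)) 0.
      by right; split=> // e'; apply: hfg; rewrite e e'.
    by left; split=> //; exact/eqP.
  apply: countableU.
    apply: (@sub_countable _ _ _ ((fun BB => urysohn_fun R BB.1 BB.2) @`
      ((@St X H @^-1` hull c C) `*` (@St X H @^-1` hull c C)))).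
      by apply: subset_card_le => k [B [B' [MB MB' ->]]]; exists (B, B').
    apply: countable_image; have cS : countable (@St X H @^-1` hull c C).
      have /countable_injP[j jI] := hull_countable c_countable cC.
      apply/countable_injP; exists (fun B => j (St H B)) => B B' MB MB' /jI.
      by rewrite !inE in MB MB' * => /(_ MB MB')[].
    exact: countableX.
  apply: bigcup_countable => [|a [Da _]]; first exact: countable_jumps.
  have [_ cK _] := FP a Da.
  apply: bigcup_countable => [|h _]; first by apply: countableU; exact: cK.
  exact: countableU.
- move=> x y Ex Ey hxy.
  have cM : closed_under c (hull c (D `|` C)) by exact: hull_closed.
  have baseE (h : X -> R) : functions_of (hull c C) h -> h x = h y.
    by move=> Fh; apply: hxy; left.
  have split_fun D' (h : X -> R) : downset D' -> D' `<=` D ->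
      (forall a, D' a -> f a x = f a y) ->
      functions_of (hull c (D' `|` C)) h -> h x = h y.
    move=> dD' D'D fxy [B [B' [MB MB' hE]]].
    have loc a : D' a -> cseg1 C a (St H B) -> cseg1 C a (St H B') -> h x = h y.
      move=> Da MB1 MB1'; have Mh : functions_of (cseg1 C a) h by exists B, B'.
      have [_ /(_ _ Mh) <-] := rP x (@closed_cseg1 C a).
      have [_ /(_ _ Mh) <-] := rP y (@closed_cseg1 C a).
      by congr h; exact: fxy.
    have sub0 a : hull c C `<=` cseg1 C a.
      exact: (subset_trans (@base_sub C a)).
    case: (hull_split MB) (hull_split MB') => [M0|[a Da Ma]] [M0'|[a' Da' Ma']].
    + by apply: baseE; exists B, B'.
    + by apply: (loc a') => //; exact: sub0.
    + by apply: (loc a) => //; exact: sub0.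
    + case/orP: (wo_total wo a a') => [aa'|a'a].
        by apply: (loc a') => //; exact: (cseg1_mono aa').
      by apply: (loc a) => //; exact: (cseg1_mono a'a).
  have fxy a : D a -> f a x = f a y.
    elim/(wo_ind wo): a => a IHa Da.
    (* Each function coded before [a] is coded in [hull c C] or in some [cseg1 C b] with [b] below
       [a], where the induction hypothesis applies. *)
    have gxy : g a x = g a y.
      apply: r_eq => //; first exact: (rP y (@closed_cseg C a)).1.
      move=> h Mh; have [_ /(_ _ Mh) ->] := rP y (@closed_cseg C a).
      apply/esym/(split_fun (seg a)) => //.
      + by move=> b ba d; apply: (below_trans wo); case/andP: ba.
      + exact: dD.
      + by move=> b ba; apply: IHa => //; exact: (dD a).
    have [_ _ sepF] := FP a Da; apply: sepF; [exact: Ef|exact: Ef|move=> h Fh].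
    have d1 : diff (f a) (g a) h x = diff (f a) (g a) h y.
      by apply: hxy; right; exists a, h; split=> //; left.
    have d2 : diff (g a) (f a) h x = diff (g a) (f a) h y.
      by apply: hxy; right; exists a, h; split=> //; right.
    have maxB u v : Num.max (u - v) 0 - Num.max (v - u) 0 = u - v :> R.
      have [uv|vu] := leP u v.
        by rewrite max_r ?subr_le0// max_l ?subr_ge0// sub0r opprB.
      by rewrite max_l ?subr_ge0 1?ltW// max_r ?subr_le0 1?ltW// subr0.
    have := congr2 (fun u v => u - v) d1 d2; rewrite /diff !maxB gxy.
    exact: addIr.
  apply: (c_retract cM).1 => // h Mh.
  by apply: (split_fun D).
Qed.

Lemma sigma_family_exists : exists F : set (X -> R), sigma_family setT F.
Proof.
have dseg a : downset (seg a).
  by move=> b ba d; apply: (below_trans wo); case/andP: ba.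
have claim_seg a : claim (seg a).
  elim/(wo_ind wo): a => a IH; apply: claim_step => // b; exact: IH.
have [//|F] := @claim_step setT _ (fun a _ => claim_seg a) set0 (countable0 _).
suff -> : E (hull c (setT `|` set0)) = setT by exists F.
rewrite eqEsubset; split=> // x _; apply: subset_closure; split=> //.
by apply: hull_sub; left.
Qed.

End retract_decomposition.

(** * Embedding into a Sigma-product and conclusion *)

Lemma continuous_ptws (Z V : topologicalType) (K : Type)
    (f : Z -> {ptws K -> V}) :
  (forall k, continuous (fun z => f z k : V)) -> continuous f.
Proof.
move=> cf z; apply/cvg_sup => k W [_ [[B oB <-] Bfz BW]].
apply: (@filterS _ (nbhs z) _ (fun w => B (f w k))); first by move=> w; exact: BW.
by apply: cf; apply: open_nbhs_nbhs.
Qed.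

(** Evaluation at the members of [F] is the embedding. Its inverse is continuous because a cluster
    point of inverse values near [a] has the coordinates of [a]. *)
Lemma sigma_family_Corson (R : realType) (X : topologicalType)
    (F : set (X -> R)) :
  compact [set: X] -> hausdorff_space X -> sigma_family setT F ->
  Corson_compact R X.
Proof.
move=> cX hX [F01 Fcount Fsep]; split=> //.
pose e (x : X) : {ptws set_type F -> R} := fun k => set_val k x.
exists (set_type F), (range e); split.
  move=> _ [x _ <-]; split=> [k|]; first exact: (F01 _ (set_valP k)).2.
  have /countable_injP[j jI] := Fcount x Logic.I.
  apply/countable_injP; exists (fun k => j (set_val k)) => k l.
  rewrite !inE => /eqP kx /eqP lx jkl; apply: val_inj; apply: jI => //; rewrite inE.
    by split; [exact: set_valP|exact: kx].
  by split; [exact: set_valP|exact: lx].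
have er x : e x \in range e by apply/mem_set; exists x.
pose f x : set_type (range e) := exist _ (e x) (er x).
have gex (a : set_type (range e)) : exists x, e x = set_val a.
  by have [x _ xa] := set_valP a; exists x.
pose g a := sval (cid (gex a)); have eg a : e (g a) = set_val a := svalP (cid (gex a)).
have eI x y : (forall k : set_type F, e x k = e y k) -> x = y.
  move=> exy; apply: Fsep => // h Fh.
  exact: (exy (exist _ h (mem_set Fh) : set_type F)).
exists f; split.
  have ce : continuous e.
    by apply: continuous_ptws => k; exact: (F01 _ (set_valP k)).1.
  move=> x V; rewrite nbhsE => -[W [[B oB <-] Bx] WV].
  apply: (@filterS _ (nbhs x) _ (e @^-1` B)); first by move=> y By; exact: WV.
  by apply: ce; apply: open_nbhs_nbhs.
exists g; split; last 2 first.
- by move=> x; apply: eI => k; rewrite eg.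
- by move=> a; apply: val_inj; exact: eg.
move=> a; apply: compact_cvg_unique_cluster => //.
  exact/fmap_proper_filter/nbhs_pfilter.
move=> x clx; apply: eI => k.
apply: (cluster_cvg_image (@Rhausdorff R) ((F01 _ (set_valP k)).1 x) clx).
have egE : set_val k \o g = fun b => (set_val b : {ptws set_type F -> R}) k.
  by apply/funext => b /=; rewrite -eg.
pose incl (b : set_type (range e)) : {ptws set_type F -> R} := set_val b.
have : {for a, continuous (fun b => incl b k)}.
  apply: (@continuous_comp _ _ _ incl (fun h : {ptws set_type F -> R} => h k)).
    exact: initial_continuous.
  exact: (@proj_continuous (set_type F) (fun=> R) k).
by rewrite -egE.
Qed.

(** Tightness is required of the image [X] only, since the spaces through which [Z] is built need
    not be tight; quantifying over all maps lets the induction keep [X] fixed. *)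
Lemma RC_club_separated (R : realType) (Z : topologicalType) : RC R Z ->
  [/\ compact [set: Z], hausdorff_space Z &
    forall (X : topologicalType) (f : Z -> X), hausdorff_space X -> countably_tight X -> continuous f ->
    club_separated (range f)].
Proof.
elim=> {Z} [Z cZ mZ|Z Y f _ [cZ hZ IH] hY cf fY|I le S wo S_cont S_retr _ IH].
- have hZ : hausdorff_space Z.
    have [M [phi [cphi [psi [cpsi phiK _]]]]] := mZ.
    move=> x y xy; rewrite -[x]phiK -[y]phiK; congr psi.
    apply: (@metric_hausdorff R M) => A B nA nB.
    have [z [Az Bz]] := xy _ _ (cphi _ _ nA) (cphi _ _ nB).
    by exists (phi z).
  split=> // X f hX _ cf; apply: second_countable_club_separated => //.
  exact: compact_metrizable_second_countable mZ.
- split=> // [|X g hX tX cg].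
    by rewrite -fY; exact: continuous_compact (continuous_subspaceT cf) cZ.
  have -> : range g = range (g \o f).
    rewrite eqEsubset; split=> _ [y _ <-]; last by exists (f y).
    by have [z _ <-] : range f y by [rewrite fY]; exists z.
  by apply: IH => // z; apply: continuous_comp; [exact: cf|exact: cg].
- have cS i : compact [set: S i] by have [] := IH i.
  have hS i : hausdorff_space (S i) by have [] := IH i.
  split.
  + exact: compact_inverse_limit.
  + exact: hausdorff_inverse_limit.
  + move=> X f hX tX cf; apply: club_separated_inverse_limit => // i g cg.
    by have [_ _] := IH i; apply.
Qed.

Theorem corollary4p4 (R : realType) (X : topologicalType)
    (hRC : RC R X) (htight : countably_tight X) :
  Corson_compact R X.
Proof.
have [cX hX sepX] := RC_club_separated hRC.
have := sepX X id hX htight (fun x => cvg_id); rewrite image_id => sepT.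
have [H [c cc cM]] := club_retract_code R cX hX htight sepT.
(* Any well-order of all the codes yields the chain of models. *)
have [le wo] := well_ordering_principle {classic univ X H}.
have [F sF] := sigma_family_exists cX hX htight cc cM wo.
exact: sigma_family_Corson sF.
Qed.
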